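(* There is a constant $C>0$, independent of $n,h,x,d$ and $\gamma$, such that for all $n,d,\gamma\in\mathbb{N}$ with $d\in[1,n]$ and $\gamma>1$, and all nodes $a=x_0<x_1<\dots<x_n=b$, the Lebesgue function of the generalized Floater--Hormann interpolation satisfies $$\Lambda_n(x)\le C\,d\,2^d\left(\frac{h}{h^*}\right)^{\gamma+d},\qquad\forall x\in[a,b].$$
   Context: $\mathbb{N}=\{1,2,3,\ldots\}$. For nodes $a=x_0<x_1<\dots<x_n=b$ let $h=\max_{0\le k<n}(x_{k+1}-x_k)$ and $h^*=\min_{0\le k<n}(x_{k+1}-x_k)$. For $1\le d\le n$ and $\gamma\in\mathbb{N}$ let $$\tilde\lambda_i(x)=(-1)^{i\gamma}\prod_{s=i}^{i+d}\frac1{(x-x_s)^\gamma}\ (0\le i\le n-d),\qquad D(x)=\sum_{i=0}^{n-d}\tilde\lambda_i(x),$$ $$J_k=\{i\in\{0,\ldots,n-d\}:k-d\le i\le k\},\qquad w_k(x)=\sum_{i\in J_k}(-1)^{i\gamma}\prod_{s=i,\,s\ne k}^{i+d}\frac{1}{(x_k-x_s)(x-x_s)^{\gamma-1}}.$$ For $k=0,\ldots,n$ define $b_k(x)=\dfrac{w_k(x)}{(x-x_k)^\gamma D(x)}$ if $x\notin\{x_0,\ldots,x_n\}$, $b_k(x_k)=1$, and $b_k(x_j)=0$ for $j\neq k$. The generalized Floater--Hormann interpolant of $f$ is $\tilde r(f,x)=\sum_{k=0}^n f(x_k)b_k(x)$, and its Lebesgue function is $\Lambda_n(x)=\sum_{k=0}^n|b_k(x)|$.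 ($D(x)\neq0$ for every real $x$ that is not a node.) *)

(* Defs.v *)
From HB Require Import structures.
From mathcomp Require Import all_boot all_order all_algebra.
From mathcomp Require Import reals.
Set Implicit Arguments.
Unset Strict Implicit.
Unset Printing Implicit Defensive.
Import Order.TTheory GRing.Theory Num.Theory.
Local Open Scope ring_scope.

(* The nodes x_0 < ... < x_n are the first n.+1 values of x : nat -> R; the
   later values are arbitrary and are never used when d <= n. *)
Section FloaterHormann.
Context {R : realType}.
Implicit Types (n d gamma i j k : nat) (x : nat -> R) (y : R).

(* The first gap x 1 - x 0 is a member of both families when 0 < n, so taking
   it as the default value of the big operators does not change them. *)
Definition max_gap n x : R :=
  \big[Num.max/x 1%N - x 0%N]_(k < n) (x k.+1 - x k).

Definition min_gap n x : R :=
  \big[Num.min/x 1%N - x 0%N]_(k < n) (x k.+1 - x k).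

Definition fh_lambda d gamma x i y : R :=
  (-1) ^+ (i * gamma) * \prod_(i <= s < (i + d).+1) ((y - x s) ^+ gamma)^-1.

Definition fh_denom n d gamma x y : R :=
  \sum_(i < (n - d).+1) fh_lambda d gamma x i y.

(* The condition k - d <= i of the index set J_k is between integers, hence
   written k <= i + d. *)
Definition fh_weight n d gamma x k y : R :=
  \sum_(i < (n - d).+1 | (k <= i + d)%N && (i <= k)%N)
    (-1) ^+ (i * gamma) *
    \prod_(i <= s < (i + d).+1 | s != k)
      ((x k - x s) * (y - x s) ^+ gamma.-1)^-1.

Definition fh_basis n d gamma x k y : R :=
  if y == x k then 1
  else if [exists j : 'I_n.+1, y == x j] then 0
  else fh_weight n d gamma x k y /
         ((y - x k) ^+ gamma * fh_denom n d gamma x y).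

Definition fh_interpolant n d gamma x (f : R -> R) y : R :=
  \sum_(k < n.+1) f (x k) * fh_basis n d gamma x k y.

Definition fh_lebesgue n d gamma x y : R :=
  \sum_(k < n.+1) `|fh_basis n d gamma x k y|.

End FloaterHormann.

(* Main.v *)
(* Let y lie in the open interval (x_m, x_{m+1}), put
   P_i = prod_{i <= s <= i+d} 1/|y - x_s| and r = h/h*, and let Q be the largest
   P_i among the stencils i <= m < i + d containing that interval.
   - |D(y)| >= Q^gamma: those stencils contribute to D with a common sign, and
     the stencils on either side form alternating sums (for odd gamma) with
     monotone terms, which start with that same sign.
   - |w_k(y)| / |y - x_k|^gamma is at most a sum over the stencils i containing k
     of P_i^(gamma-1) / (|y - x_k| prod_{s != k} |x_k - x_s|).  Since
     1/Q <= |y - x_m| |y - x_{m+1}| d! h^(d-1), dividing by Q^gamma bounds each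
     term by (P_i/Q)^(gamma-1) C(d, k-i) r^d, and the binomials sum to 2^d.
   - The (at most d) central ratios P_i/Q are at most 1.  For a stencil at index
     distance l from the central ones, cancelling the common shape of P_i and of
     the nearest central product leaves P_i/Q <= |y-x_m| |y-x_{m+1}| /
     (|y-x_i| |y-x_{i+d}|), which is at most r and at most 3r^2/((l+1)(l+2)).
     Hence sum_i (P_i/Q)^(gamma-1) <= d + 6 r^gamma <= 7 d r^gamma. *)
Require Import Defs.
From HB Require Import structures.
From mathcomp Require Import all_boot all_order all_algebra.
From mathcomp Require Import reals.
From mathcomp Require Import zify ring lra.
Set Implicit Arguments.
Unset Strict Implicit.
Unset Printing Implicit Defensive.
Import Order.TTheory GRing.Theory Num.Theory.
Local Open Scope ring_scope.

(** * Factorials and elementary finite sums *)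

(** Passing from [p] to [p.+1] multiplies the left side by [p.+2] and the right side by
    [(p + q).+2], which is no smaller. *)
Lemma fact_mul_le (p q : nat) : (p.+1`! * q.+1`! <= (p + q).+1`!)%N.
Proof.
elim: p => [|p IHp]; first by rewrite mul1n.
rewrite factS -mulnA addSn [X in (_ <= X)%N]factS leq_mul //.
by rewrite -addSn leq_addr.
Qed.

(** The first block is reversed so that both outer blocks are indexed by their distance from the
    middle one; [minn] covers [N < c], where the last block is empty. *)
Lemma sum_ord_split (V : nmodType) (F : nat -> V) (N a c : nat) :
  (a <= minn c N)%N ->
  \sum_(i < N) F i = \sum_(k < a) F (a - k.+1)%N
    + \sum_(a <= i < minn c N) F i + \sum_(k < N - c) F (c + k)%N.
Proof.
move=> ha; rewrite -(big_mkord xpredT F).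
rewrite (big_cat_nat _ (n := a)) //=; last by lia.
rewrite (big_cat_nat _ (n := minn c N) (m := a)) //=; last by lia.
rewrite addrA; congr (_ + _ + _).
  by rewrite big_nat_rev big_mkord.
case: (leqP c N) => hcN.
  by rewrite -[X in \sum_(X <= _ < _) _]add0n big_addn big_mkord;
    apply: eq_bigr => k _; rewrite addnC.
rewrite big_geq // (_ : N - c = 0)%N; first by rewrite big_ord0.
lia.
Qed.

(** The terms telescope, being differences of consecutive reciprocals. *)
Lemma sum_inv_consecutive_le1 (R : realFieldType) (N : nat) :
  \sum_(l < N) (l.+1%:R * l.+2%:R)^-1 <= 1 :> R.
Proof.
suff -> : \sum_(l < N) (l.+1%:R * l.+2%:R)^-1 = 1 - N.+1%:R^-1 :> R.
  by rewrite gerBl invr_ge0.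
elim: N => [|N IHN]; first by rewrite big_ord0 invr1 subrr.
rewrite big_ord_recr /= IHN -!natr1.
have hN : (0 : R) <= N%:R by [].
by field; apply/andP; split; lra.
Qed.

Lemma sum_bin_window (n d i : nat) : (i + d <= n)%N ->
  (\sum_(k < n.+1 | (k <= i + d) && (i <= k)) 'C(d, k - i) = 2 ^ d)%N.
Proof.
move=> idn; rewrite -(big_mkord (fun k => (k <= i + d) && (i <= k))%N
  (fun k => 'C(d, k - i))).
have -> : (\sum_(0 <= k < n.+1 | (k <= i + d) && (i <= k)) 'C(d, k - i)
    = \sum_(i <= k < (i + d).+1) 'C(d, k - i))%N.
  rewrite [RHS](@big_nat_widen _ _ _ _ _ n.+1) ?ltnS //.
  by rewrite [RHS](@big_nat_widenl _ _ _ _ 0%N).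
rewrite -{1}[i]add0n big_addn big_mkord -addnS addKn.
rewrite -[2%N]/(1 + 1)%N expnDn.
by apply: eq_bigr => k _; rewrite !exp1n !muln1 addnK.
Qed.

(** * Sums with alternating signs *)

Section AlternatingSums.
Context {R : realDomainType}.
Implicit Types (u : nat -> R) (g N : nat).

(** Splitting off the first term leaves [u 0] minus a sum of the same kind, which lies between [0]
    and [u 1]; the induction therefore needs both bounds at once. *)
Lemma alternating_sum_bounds u N :
  (forall k, (k < N)%N -> 0 <= u k) ->
  (forall k, (k.+1 < N)%N -> u k.+1 <= u k) ->
  0 <= \sum_(k < N) (-1) ^+ k * u k /\
  ((0 < N)%N -> \sum_(k < N) (-1) ^+ k * u k <= u 0%N).
Proof.
elim: N u => [|N IHN] u u0 udec; first by rewrite big_ord0.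
have [||s0 s1] := IHN (fun k => u k.+1).
- by move=> k hk; apply: u0.
- by move=> k hk; apply: udec.
rewrite big_ord_recl /= expr0 mul1r.
have -> : \sum_(i < N) (-1) ^+ bump 0 i * u (bump 0 i)
    = - \sum_(i < N) (-1) ^+ i * u i.+1.
  by rewrite -sumrN; apply: eq_bigr => i _; rewrite /bump exprS; ring.
split; last by move=> _; lra.
case: N {IHN} u0 udec s0 s1 => [|N] u0 udec s0 s1.
  by rewrite big_ord0 oppr0 addr0 u0.
by have := s1 isT; have := udec 0%N isT; lra.
Qed.

(** Treats both parities of [g] together: for even [g] every sign is positive. *)
Lemma signed_sum_ge0 g u N :
  (forall k, (k < N)%N -> 0 <= u k) ->
  (forall k, (k.+1 < N)%N -> u k.+1 <= u k) ->
  0 <= \sum_(k < N) ((-1) ^+ g) ^+ k * u k.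
Proof.
move=> u0 udec; rewrite -(signr_odd R g); case: (odd g); last first.
  by apply: sumr_ge0 => k _; rewrite expr0 expr1n mul1r u0.
by have [] := alternating_sum_bounds u0 udec.
Qed.

Lemma signX_odd g a b : odd a = odd b ->
  ((-1) ^+ g) ^+ a = ((-1) ^+ g) ^+ b :> R.
Proof.
move=> hab; rewrite -!exprM -(signr_odd R (g * a)) -(signr_odd R (g * b)).
by rewrite !oddM hab.
Qed.

End AlternatingSums.

Lemma between_consecutive (R : realDomainType) (x : nat -> R) (y : R) (n : nat) :
  x 0%N <= y <= x n -> (forall k, (k <= n)%N -> y != x k) ->
  exists2 m, (m < n)%N & x m < y < x m.+1.
Proof.
elim: n => [|n IHn] /andP[y0 yn] ynode.
  by have := ynode 0%N isT; rewrite eq_le y0 yn.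
have [ylt | ] := ltP y (x n).
  have [||m mn hm] := IHn; first by rewrite y0 ltW.
    by move=> k hk; apply: ynode; lia.
  by exists m => //; lia.
move=> yge; exists n => //; rewrite !lt_neqAle yn yge ynode // andbT.
by rewrite eq_sym ynode.
Qed.

(** * Node differences in terms of the gaps *)

Section Gaps.
Context {R : realType}.
Variables (n : nat) (x : nat -> R).

Lemma gap_le_max_gap k : (k < n)%N -> x k.+1 - x k <= max_gap n x.
Proof.
move=> hk; exact: (le_bigmax _ (fun i : 'I_n => x i.+1 - x i) (Ordinal hk)).
Qed.

Lemma min_gap_le_gap k : (k < n)%N -> min_gap n x <= x k.+1 - x k.
Proof.
move=> hk; exact: (bigmin_le _ (Ordinal hk) (fun i : 'I_n => x i.+1 - x i)).
Qed.

Lemma node_sub_le i j : (i <= j <= n)%N ->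
  x j - x i <= (j - i)%:R * max_gap n x.
Proof.
elim: j => [|j IHj] /andP[ij jn].
  by have -> : i = 0%N by [lia]; rewrite subrr mul0r.
have [->|ne] := eqVneq i j.+1; first by rewrite subrr subnn mul0r.
have /IHj : (i <= j <= n)%N by lia.
rewrite subSn; last by lia.
have := gap_le_max_gap jn; rewrite -natr1; lra.
Qed.

Lemma node_sub_ge i j : (i <= j <= n)%N ->
  (j - i)%:R * min_gap n x <= x j - x i.
Proof.
elim: j => [|j IHj] /andP[ij jn].
  by have -> : i = 0%N by [lia]; rewrite subrr mul0r.
have [->|ne] := eqVneq i j.+1; first by rewrite subrr subnn mul0r.
have /IHj : (i <= j <= n)%N by lia.
rewrite subSn; last by lia.
have := min_gap_le_gap jn; rewrite -natr1; lra.
Qed.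

Lemma min_gap_gt0 : (0 < n)%N -> (forall k, (k < n)%N -> x k < x k.+1) ->
  0 < min_gap n x.
Proof.
move=> n0 xinc; apply: lt_bigmin => [|i _]; rewrite subr_gt0; exact: xinc.
Qed.

Lemma node_lt i j : (forall k, (k < n)%N -> x k < x k.+1) ->
  (i < j <= n)%N -> x i < x j.
Proof.
move=> x_incr /andP[ij jn]; rewrite -subr_gt0.
have hij : (i <= j <= n)%N by rewrite ltnW.
apply: lt_le_trans (node_sub_ge hij).
by rewrite mulr_gt0 ?ltr0n ?subn_gt0 // min_gap_gt0 //; lia.
Qed.

Lemma min_gap_le_max_gap : (0 < n)%N -> min_gap n x <= max_gap n x.
Proof.
move=> n0; exact: le_trans (min_gap_le_gap n0) (gap_le_max_gap n0).
Qed.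

End Gaps.

(** * Products over index intervals *)

Section Products.
Context {R : realFieldType}.
Implicit Types (F : nat -> R) (c : R).

Lemma prod_nat_rev F i k : (i <= k)%N ->
  \prod_(i <= s < k) F s = \prod_(j < k - i) F (k - j.+1)%N.
Proof.
move=> ik; rewrite -{1}[i]add0n big_addn big_nat_rev big_mkord.
by apply: eq_bigr => j _; congr F; have := ltn_ord j; lia.
Qed.

Lemma prod_nat_shift F i k :
  \prod_(i <= s < k) F s = \prod_(j < k - i) F (i + j)%N.
Proof.
rewrite -{1}[i]add0n big_addn big_mkord.
by apply: eq_bigr => j _; rewrite addnC.
Qed.

Lemma prod_succ_scale c q : \prod_(j < q) (j.+1%:R * c) = q`!%:R * c ^+ q.
Proof.
elim: q => [|q IHq]; first by rewrite big_ord0 mul1r.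
by rewrite big_ord_recr /= IHq factS natrM exprS; ring.
Qed.

Lemma prod_succ2_scale c q : \prod_(j < q) (j.+2%:R * c) = q.+1`!%:R * c ^+ q.
Proof.
elim: q => [|q IHq]; first by rewrite big_ord0 mul1r.
by rewrite big_ord_recr /= IHq (factS q.+1) natrM exprS; ring.
Qed.

End Products.

(** * Scalar estimates and signs for the stencil products *)

(* [A], [N] are the distances from [y] to the two nodes on the nearer side, at
   the ends of the current interval and of the stencil; [B], [F] likewise on
   the farther side. *)
Lemma end_ratio_le (R : realFieldType) (h hs A B N F : R) (l : nat) :
  0 < hs -> hs <= h ->
  0 < A -> 0 < B -> A <= h -> B <= h -> A <= N -> l%:R * hs <= N ->
  l.+1%:R * hs <= F ->
  A * B / (N * F) <= h / hs /\
  A * B / (N * F) <= 3 * (h / hs) ^+ 2 * (l.+1%:R * l.+2%:R)^-1.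
Proof.
move=> hs_gt0 hs_le_h A0 B0 Ah Bh AN lN lF.
have ratio_ge1 : 1 <= h / hs by rewrite ler_pdivlMr // mul1r.
have N0 : 0 < N by exact: lt_le_trans AN.
have F0 : 0 < F by apply: lt_le_trans lF; rewrite mulr_gt0.
have BF : B / F <= h / hs * l.+1%:R^-1.
  rewrite ler_pdivrMr // (le_trans Bh) //.
  apply: le_trans (ler_wpM2l _ lF); last by rewrite !mulr_ge0 ?invr_ge0 // ltW // (lt_le_trans hs_gt0).
  by rewrite mulrA mulfVK ?pnatr_eq0 // mulfVK ?gt_eqF.
(* The 3 comes from [l + 2 <= 3 l] for [l >= 1]; for [l = 0] the bound [A <= N] suffices. *)
have AN3 : A / N <= 3 * (h / hs) * l.+2%:R^-1.
  rewrite ler_pdivrMr // mulrAC ler_pdivlMr //.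
  have r0 : 0 <= h / hs by exact: le_trans ler01 ratio_ge1.
  have rN : N <= h / hs * N by apply: ler_peMl => //; exact: ltW.
  case: l lN {lF BF} => [|l] lN; first by lra.
  have hN : h * l.+1%:R <= h / hs * N.
    apply: le_trans (ler_wpM2l r0 lN).
    by rewrite mulrCA mulfVK ?gt_eqF // mulrC.
  have : A * l.+3%:R <= h * l.+3%:R by apply: ler_wpM2r.
  have : h * l.+3%:R <= h * (3 * l.+1%:R).
    apply: ler_wpM2l; first by apply: le_trans hs_le_h; exact: ltW.
    by have := ler0n R l; rewrite -!natr1; lra.
  by lra.
have -> : A * B / (N * F) = A / N * (B / F) by rewrite invfM mulrACA.
have AN0 : 0 <= A / N by rewrite divr_ge0 // ltW.
have BF0 : 0 <= B / F by rewrite divr_ge0 // ltW.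
split; last first.
  apply: le_trans (ler_pM AN0 BF0 AN3 BF) _.
  by rewrite invfM expr2 le_eqVlt; apply/orP; left; apply/eqP; ring.
rewrite -[X in _ <= X]mul1r; apply: ler_pM => //.
  by rewrite ler_pdivrMr // mul1r.
apply: le_trans BF _; rewrite ler_piMr ?invf_le1 ?ler1n //; lra.
Qed.

(** One of the [g - 1] factors takes the decaying bound and the other [g - 2] take [r], hence the
    power [r ^+ g]. *)
Lemma power_bound (R : realFieldType) (t r c : R) (g : nat) :
  (1 < g)%N -> 0 <= t -> t <= r -> t <= 3 * r ^+ 2 * c ->
  t ^+ g.-1 <= 3 * r ^+ g * c.
Proof.
case: g => [|[|g]] // _ t0 tr tc.
have -> : 3 * r ^+ g.+2 * c = r ^+ g * (3 * r ^+ 2 * c) by rewrite -[g.+2]addn2 exprD; ring.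
rewrite /= exprSr; apply: ler_pM => //; first exact: exprn_ge0.
by rewrite lerXn2r // nnegrE (le_trans t0).
Qed.

(** The exponent counts the indices beyond [m] in [[a, b)]; truncated subtraction makes it 0 when
    there are none. *)
Lemma sign_prodE (R : pzSemiRingType) (e : R) (m a b : nat) : (a <= b)%N ->
  \prod_(a <= s < b) (if (s <= m)%N then 1 else e) = e ^+ (b - maxn a m.+1).
Proof.
elim: b => [|b IHb] ab; first by rewrite big_geq.
have [->|ne] := eqVneq a b.+1.
  by rewrite big_geq // (_ : b.+1 - maxn b.+1 m.+1 = 0)%N //; lia.
rewrite big_nat_recr /=; last by lia.
rewrite IHb; last by lia.
case: leqP => bm.
  by rewrite mulr1; congr (_ ^+ _); lia.
by rewrite -exprSr; congr (_ ^+ _); lia.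
Qed.

(** The magnitude of [fh_lambda] is the [gamma]-th power of this product. *)
Definition inv_dist_prod (R : realType) (d : nat) (x : nat -> R) (y : R) (i : nat) : R :=
  \prod_(i <= s < (i + d).+1) `|y - x s|^-1.

(** * Distances from a point inside a gap to the nodes *)

Section LocatedPoint.
Context {R : realType}.
Variables (n d m : nat) (x : nat -> R) (y : R).
Hypotheses (d_gt0 : (0 < d)%N) (d_le_n : (d <= n)%N) (m_lt_n : (m < n)%N).
Hypothesis x_incr : forall k, (k < n)%N -> x k < x k.+1.
Hypothesis y_loc : x m < y < x m.+1.

Local Notation h := (max_gap n x).
Local Notation hs := (min_gap n x).
Local Notation dist s := `|y - x s|.
Local Notation P := (inv_dist_prod d x y).

Let hs_gt0 : 0 < hs.
Proof. by apply: min_gap_gt0 => //; lia. Qed.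

Let hs_le_h : hs <= h.
Proof. by apply: min_gap_le_max_gap; lia. Qed.

Let ratio_ge1 : 1 <= h / hs.
Proof. by rewrite ler_pdivlMr // mul1r. Qed.

Lemma node_le i j : (i <= j <= n)%N -> x i <= x j.
Proof.
move=> hij; rewrite -subr_ge0; apply: le_trans (node_sub_ge x hij).
by rewrite mulr_ge0 // ltW.
Qed.

Lemma dist_left s : (s <= m)%N -> dist s = y - x s.
Proof.
move=> sm; rewrite ger0_norm // subr_ge0.
have : x s <= x m by apply: node_le; lia.
by case/andP: y_loc; lra.
Qed.

Lemma dist_right s : (m < s <= n)%N -> dist s = x s - y.
Proof.
move=> sm; rewrite distrC ger0_norm // subr_ge0.
have : x m.+1 <= x s by apply: node_le; lia.
by case/andP: y_loc; lra.
Qed.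

Lemma dist_gt0 s : (s <= n)%N -> 0 < dist s.
Proof.
case/andP: y_loc => y1 y2 sn; case: (leqP s m) => sm.
  rewrite dist_left //; have : x s <= x m by apply: node_le; lia.
  by lra.
rewrite dist_right ?sm //; have : x m.+1 <= x s by apply: node_le; lia.
by lra.
Qed.

Lemma dist_left_le s t : (s <= t <= m)%N -> dist t <= dist s.
Proof.
move=> st; rewrite !dist_left; try lia.
by rewrite lerB // node_le //; lia.
Qed.

Lemma dist_right_le s t : (m < s)%N -> (s <= t <= n)%N -> dist s <= dist t.
Proof.
move=> ms st; rewrite !dist_right; try lia.
by rewrite lerB // node_le //; lia.
Qed.

(** Measuring to the end of the interval beyond [y] costs one extra gap; the lower bounds below
    measure to the near end instead. *)
Lemma dist_left_ub s : (s <= m)%N -> dist s <= (m.+1 - s)%:R * h.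
Proof.
move=> sm; rewrite dist_left //; case/andP: y_loc => _ y2.
have := @node_sub_le R n x s m.+1.
move=> /(_ ltac:(lia)); lra.
Qed.

Lemma dist_right_ub s : (m < s <= n)%N -> dist s <= (s - m)%:R * h.
Proof.
move=> sm; rewrite dist_right //; case/andP: y_loc => y1 _.
have := @node_sub_le R n x m s.
move=> /(_ ltac:(lia)); lra.
Qed.

Lemma dist_left_lb s : (s <= m)%N -> (m - s)%:R * hs <= dist s.
Proof.
move=> sm; rewrite dist_left //; case/andP: y_loc => y1 _.
have := @node_sub_ge R n x s m.
move=> /(_ ltac:(lia)); lra.
Qed.

Lemma dist_right_lb s : (m < s <= n)%N -> (s - m.+1)%:R * hs <= dist s.
Proof.
move=> sm; rewrite dist_right //; case/andP: y_loc => _ y2.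
have := @node_sub_ge R n x m.+1 s.
move=> /(_ ltac:(lia)); lra.
Qed.

(** * Products of inverse distances over stencils *)

Lemma inv_dist_prodE i : P i = \prod_(j < d.+1) (dist (i + j))^-1.
Proof.
by rewrite /inv_dist_prod prod_nat_shift -addnS addKn.
Qed.

Lemma inv_dist_prod_gt0 i : (i + d <= n)%N -> 0 < P i.
Proof.
move=> hi; rewrite inv_dist_prodE; apply: prodr_gt0 => j _.
by rewrite invr_gt0 dist_gt0 //; have := ltn_ord j; lia.
Qed.

(** Moving the stencil one step towards [y] brings each of its nodes closer to [y]. *)
Lemma inv_dist_prod_incr_left i : (i.+1 + d <= m)%N -> P i <= P i.+1.
Proof.
move=> hi; rewrite !inv_dist_prodE; apply: ler_prod => j _.
have := ltn_ord j => hj.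
rewrite invr_ge0 ltW ?dist_gt0; try lia.
by rewrite lef_pV2 ?posrE ?dist_gt0 ?dist_left_le //; lia.
Qed.

Lemma inv_dist_prod_decr_right i :
  (m < i)%N -> (i.+1 + d <= n)%N -> P i.+1 <= P i.
Proof.
move=> mi hi; rewrite !inv_dist_prodE; apply: ler_prod => j _.
have := ltn_ord j => hj.
rewrite invr_ge0 ltW ?dist_gt0; try lia.
by rewrite lef_pV2 ?posrE ?dist_gt0 ?dist_right_le //; lia.
Qed.

Lemma inv_dist_prod_ends i : (i + d <= n)%N ->
  P i * (dist i * dist (i + d)) = \prod_(j < d.-1) (dist (i.+1 + j))^-1.
Proof.
move=> hi; rewrite inv_dist_prodE big_ord_recl.
rewrite -[in LHS](prednK d_gt0) big_ord_recr /= addn0 /bump /=.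
rewrite !add1n prednK //.
have -> : \prod_(i0 < d.-1) (dist (i + (1 + i0)))^-1
   = \prod_(j < d.-1) (dist (i.+1 + j))^-1.
  by apply: eq_bigr => j _; rewrite addnA addn1.
have := dist_gt0 hi; have := @dist_gt0 i ltac:(lia) => d1 d2.
by field; rewrite !gt_eqF.
Qed.

(** The central stencil starting at [m.+1 - d] ends at [m.+1]. Without [x m] and [x m.+1] it keeps
    [d - 1] nodes, which are, taken in order, at least as close to [y] as the interior nodes of
    stencil [i]. *)
Lemma inv_dist_prod_left_le i : (i + d <= m)%N ->
  P i * (dist i * dist (i + d)) <= dist m * dist m.+1 * P (m.+1 - d)%N.
Proof.
move=> hi; rewrite inv_dist_prod_ends; last by lia.
have -> : dist m * dist m.+1 * P (m.+1 - d)%N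
    = \prod_(j < d.-1) (dist (m.+1 - d + j))^-1.
  rewrite inv_dist_prodE big_ord_recr /= -[in LHS](prednK d_gt0) big_ord_recr /=.
  rewrite prednK // subnK; last by lia.
  have -> : (m.+1 - d + d.-1 = m)%N by lia.
  have := @dist_gt0 m ltac:(lia); have := dist_gt0 m_lt_n => d1 d2.
  by field; rewrite !gt_eqF.
apply: ler_prod => j _; have := ltn_ord j => hj.
rewrite invr_ge0 ltW ?dist_gt0; try lia.
by rewrite lef_pV2 ?posrE ?dist_gt0 ?dist_left_le //; lia.
Qed.

(** Mirror image, with the central stencil starting at [m]. *)
Lemma inv_dist_prod_right_le i : (m < i)%N -> (i + d <= n)%N ->
  P i * (dist i * dist (i + d)) <= dist m * dist m.+1 * P m.
Proof.
move=> mi hi; rewrite inv_dist_prod_ends; last by lia.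
have -> : dist m * dist m.+1 * P m = \prod_(j < d.-1) (dist (m.+2 + j))^-1.
  rewrite inv_dist_prodE big_ord_recl /= -[in LHS](prednK d_gt0) big_ord_recl /=.
  rewrite addn0 /bump !add1n addn1.
  have -> : \prod_(i0 < d.-1) (dist (m + (1 + (1 + i0))))^-1
     = \prod_(j < d.-1) (dist (m.+2 + j))^-1.
    by apply: eq_bigr => j _; congr `|_ - x _|^-1; lia.
  have := @dist_gt0 m ltac:(lia); have := dist_gt0 m_lt_n => d1 d2.
  by field; rewrite !gt_eqF.
apply: ler_prod => j _; have := ltn_ord j => hj.
rewrite invr_ge0 ltW ?dist_gt0; try lia.
by rewrite lef_pV2 ?posrE ?dist_gt0 ?dist_right_le //; lia.
Qed.

(** The other nodes on each side lie within [2h], [3h], ... of [y], and [fact_mul_le] merges the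
    resulting factorials. The two nearest distances stay exact so that they can absorb [1/|y - x_k|]
    later. *)
Lemma inv_dist_prod_lb k : (k <= m < k + d)%N -> (k + d <= n)%N ->
  (P k)^-1 <= dist m * dist m.+1 * (d`!%:R * h ^+ d.-1).
Proof.
move=> /andP[km mkd] kdn.
have h_ge0 : 0 <= h by apply: le_trans hs_le_h; rewrite ltW.
rewrite /inv_dist_prod prodfV invrK.
rewrite (big_cat_nat _ (n := m)) //=; last by lia.
rewrite (big_ltn (m := m)); last by lia.
rewrite (big_ltn (m := m.+1)); last by lia.
rewrite prod_nat_rev // prod_nat_shift.
have left_le : \prod_(j < m - k) dist (m - j.+1)%N
    <= (m - k).+1`!%:R * h ^+ (m - k).
  rewrite -prod_succ2_scale; apply: ler_prod => j _.
  rewrite normr_ge0 /=; apply: le_trans (dist_left_ub _) _; first by lia.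
  by rewrite (_ : m.+1 - (m - j.+1) = j.+2)%N //; have := ltn_ord j; lia.
have right_le : \prod_(j < (k + d).+1 - m.+2) dist (m.+2 + j)%N
    <= ((k + d).+1 - m.+2).+1`!%:R * h ^+ ((k + d).+1 - m.+2).
  rewrite -prod_succ2_scale; apply: ler_prod => j _.
  have := ltn_ord j => hj.
  rewrite normr_ge0 /=; apply: le_trans (dist_right_ub _) _; first by lia.
  by rewrite (_ : m.+2 + j - m = j.+2)%N //; lia.
have fact_le : (m - k).+1`!%:R * ((k + d).+1 - m.+2).+1`!%:R <= d`!%:R :> R.
  rewrite -natrM ler_nat; apply: leq_trans (fact_mul_le _ _) _.
  by rewrite (_ : (m - k + ((k + d).+1 - m.+2)).+1 = d)%N //; lia.
have -> : d.-1 = (m - k + ((k + d).+1 - m.+2))%N by lia.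
set a := (m - k)%N in left_le fact_le *.
set b := ((k + d).+1 - m.+2)%N in right_le fact_le *.
set L := \prod_(j < a) _ in left_le *.
set Q := \prod_(j < b) _ in right_le *.
have -> : L * (dist m * (dist m.+1 * Q)) = dist m * dist m.+1 * (L * Q) by ring.
apply: ler_wpM2l; first by rewrite mulr_ge0 ?normr_ge0.
have L0 : 0 <= L by apply: prodr_ge0 => j _; apply: normr_ge0.
have Q0 : 0 <= Q by apply: prodr_ge0 => j _; apply: normr_ge0.
apply: le_trans (ler_pM L0 Q0 left_le right_le) _.
rewrite exprD mulrACA ler_wpM2r // mulr_ge0 // exprn_ge0 //.
Qed.

(** The interval end on the same side as [x k] is no farther from [y] than [x k]; the other end is
    within [h]. *)
Lemma dist_mul_div_le k : (k <= n)%N -> dist m * dist m.+1 / dist k <= h.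
Proof.
move=> kn; rewrite ler_pdivrMr ?dist_gt0 //.
have dm := @dist_left_ub m (leqnn m); rewrite subSnn mul1r in dm.
have dm1 := @dist_right_ub m.+1; rewrite subSnn mul1r in dm1.
have {}dm1 := dm1 ltac:(lia).
have [km|mk] := leqP k m.
  rewrite mulrC; apply: ler_pM; rewrite ?normr_ge0 //.
  by apply: dist_left_le; lia.
apply: ler_pM; rewrite ?normr_ge0 //.
by apply: dist_right_le; lia.
Qed.

(** Nodes [j] indices apart differ by at least [j * hs]; the two factorials become the denominator
    of a binomial coefficient. *)
Lemma node_dist_prod_lb i k : (i <= k <= i + d)%N -> (i + d <= n)%N ->
  ((k - i)`! * (i + d - k)`!)%:R * hs ^+ d
    <= \prod_(i <= s < (i + d).+1 | s != k) `|x k - x s|.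
Proof.
move=> /andP[ik kd] idn.
rewrite (big_cat_nat _ (n := k)) //=; last by lia.
have -> : \prod_(k <= s < (i + d).+1 | s != k) `|x k - x s|
    = \prod_(k.+1 <= s < (i + d).+1) `|x k - x s|.
  rewrite big_mkcond big_ltn ?ltnS // eqxx /= mul1r -big_mkcond big_nat_cond.
  by rewrite [RHS]big_nat_cond; apply: eq_bigl => s /=; lia.
have -> : \prod_(i <= s < k | s != k) `|x k - x s|
    = \prod_(i <= s < k) `|x k - x s|.
  by rewrite big_nat_cond [RHS]big_nat_cond; apply: eq_bigl => s /=; lia.
rewrite prod_nat_rev // prod_nat_shift subSS natrM.
have -> : hs ^+ d = hs ^+ (k - i) * hs ^+ (i + d - k).
  by rewrite -exprD; congr (_ ^+ _); lia.
rewrite mulrACA -!prod_succ_scale.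
apply: ler_pM; try by apply: prodr_ge0 => j _; rewrite mulr_ge0 // ltW.
- apply: ler_prod => j _; have := ltn_ord j => hj.
  rewrite mulr_ge0 ?(ltW hs_gt0) //=.
  rewrite ger0_norm; last by rewrite subr_ge0 node_le //; lia.
  apply: le_trans (node_sub_ge (n := n) x _); last by lia.
  by rewrite (_ : k - (k - j.+1) = j.+1)%N //; lia.
- apply: ler_prod => j _; have := ltn_ord j => hj.
  rewrite mulr_ge0 ?(ltW hs_gt0) //=.
  rewrite distrC ger0_norm; last by rewrite subr_ge0 node_le //; lia.
  apply: le_trans (node_sub_ge (n := n) x _); last by lia.
  by rewrite (_ : k.+1 + j - k = j.+1)%N //; lia.
Qed.

Lemma inv_dist_prod_ge0 i : 0 <= P i.
Proof. by apply: prodr_ge0 => s _; rewrite invr_ge0. Qed.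

(** * Signs and lower bound of the denominator *)

(** Each stencil node to the right of [y] contributes a factor [(-1) ^+ gamma]; their number is
    added to the exponent [i]. *)
Lemma fh_lambdaE gamma i : (i + d <= n)%N ->
  fh_lambda d gamma x i y
  = ((-1) ^+ gamma) ^+ (i + ((i + d).+1 - maxn i m.+1)) * P i ^+ gamma.
Proof.
move=> hi; rewrite /fh_lambda exprD -sign_prodE; last by lia.
rewrite -[in RHS]mulrA mulnC exprM; congr (_ * _).
rewrite -prodrXl -big_split /=; apply: eq_big_nat => s hs.
rewrite exprVn; case: leqP => sm.
  by rewrite (dist_left sm) mul1r.
rewrite (dist_right (s := s)); last by lia.
rewrite -[y - x s]opprB.
by rewrite [(- (x s - y)) ^+ _]exprNn invfM invr_sign.
Qed.

(* For odd [gamma] the stencils containing the current interval contribute with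
   one common sign, and the two outer blocks alternate with terms that decrease
   away from [y], starting with that same sign. *)
Lemma fh_denom_lb gamma k : (k <= m < k + d)%N -> (k + d <= n)%N ->
  P k ^+ gamma <= `|fh_denom n d gamma x y|.
Proof.
move=> hk kdn; set e : R := (-1) ^+ gamma.
have e_norm a : `|e ^+ a| = 1 by rewrite !normrX normrN1 !expr1n.
(* [e ^+ (d + m)] is the sign of the central stencils, whose exponents [2 i + d - m] all have the
   parity of [d + m]. *)
rewrite -[X in _ <= X]mul1r -(e_norm (d + m)%N) -normrM.
apply: le_trans (ler_norm _).
rewrite /fh_denom mulr_sumr.
(* The middle block holds the stencils containing both [m] and [m.+1]; [m.+1 - d] truncates to 0
   when [m < d]. *)
rewrite (@sum_ord_split _ (fun i => e ^+ (d + m) * fh_lambda d gamma x i y)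
  _ (m.+1 - d) m.+1); last by lia.
have e_even a : ~~ odd a -> e ^+ a = 1.
  by move=> ha; rewrite (@signX_odd _ _ a 0) ?expr0 //; apply/negbTE.
have left_ge0 : 0 <= \sum_(j < m.+1 - d)
    e ^+ (d + m) * fh_lambda d gamma x (m.+1 - d - j.+1) y.
  rewrite (eq_bigr (fun j : 'I__ => e ^+ j * P (m.+1 - d - j.+1)%N ^+ gamma)).
    apply: (@signed_sum_ge0 _ gamma (fun j => P (m.+1 - d - j.+1)%N ^+ gamma)).
      by move=> j _; rewrite exprn_ge0 ?inv_dist_prod_ge0.
    move=> j hj; rewrite lerXn2r ?nnegrE ?inv_dist_prod_ge0 //.
    have -> : (m.+1 - d - j.+1 = (m.+1 - d - j.+2).+1)%N by lia.
    by apply: inv_dist_prod_incr_left; lia.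
  move=> j _; have := ltn_ord j => hj; rewrite fh_lambdaE; last by lia.
  by rewrite mulrA -exprD; congr (_ * _); apply: signX_odd; lia.
have right_ge0 : 0 <= \sum_(j < (n - d).+1 - m.+1)
    e ^+ (d + m) * fh_lambda d gamma x (m.+1 + j) y.
  rewrite (eq_bigr (fun j : 'I__ => e ^+ j * P (m.+1 + j)%N ^+ gamma)).
    apply: (@signed_sum_ge0 _ gamma (fun j => P (m.+1 + j)%N ^+ gamma)).
      by move=> j _; rewrite exprn_ge0 ?inv_dist_prod_ge0.
    move=> j hj; rewrite lerXn2r ?nnegrE ?inv_dist_prod_ge0 //.
    by rewrite addnS; apply: inv_dist_prod_decr_right; lia.
  move=> j _; have := ltn_ord j => hj; rewrite fh_lambdaE; last by lia.
  by rewrite mulrA -exprD; congr (_ * _); apply: signX_odd; lia.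
suff : P k ^+ gamma <= \sum_(m.+1 - d <= i < minn m.+1 (n - d).+1)
    e ^+ (d + m) * fh_lambda d gamma x i y by move=> ?; lra.
rewrite (eq_big_nat _ _ (F2 := fun i => P i ^+ gamma)); last first.
  move=> i hi; rewrite fh_lambdaE; last by lia.
  by rewrite mulrA -exprD e_even ?mul1r //; lia.
rewrite (bigD1_seq k) ?iota_uniq ?mem_index_iota //=; last by lia.
by rewrite lerDl sumr_ge0 // => i _; rewrite exprn_ge0 ?inv_dist_prod_ge0.
Qed.

(** * Decay of the ratios of stencil products *)

Lemma inv_dist_prod_ratio gamma Q i :
  (1 < gamma)%N -> (i + d <= n)%N -> 0 < Q ->
  (forall k, (k <= m < k + d)%N -> (k + d <= n)%N -> P k <= Q) ->
  (P i / Q) ^+ gamma.-1 <=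
    if (i + d <= m)%N then
      3 * (h / hs) ^+ gamma * ((m - (i + d)).+1%:R * (m - (i + d)).+2%:R)^-1
    else if (i <= m)%N then 1
    else 3 * (h / hs) ^+ gamma * ((i - m.+1).+1%:R * (i - m.+1).+2%:R)^-1.
Proof.
move=> g1 idn.
have i_le_n : (i <= n)%N by lia.
have m_le_n : (m <= n)%N by lia.
have m1_range : (m < m.+1 <= n)%N by lia.
have left_idx : (i + d <= m)%N -> [/\ (m.+1 - d <= m < m.+1 - d + d)%N,
    (m.+1 - d + d <= n)%N, (i <= m)%N & ((m - (i + d)).+1 <= m - i)%N].
  by move=> idm; split; lia.
have mid_idx : (m < i + d)%N -> (i <= m)%N -> (i <= m < i + d)%N by lia.
have right_idx : (m < i)%N -> [/\ (m <= m < m + d)%N, (m + d <= n)%N,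
    (m < i + d <= n)%N, (m.+1 <= i <= n)%N &
    ((i - m.+1).+1 <= i + d - m.+1)%N].
  by move=> mi; split; lia.
move=> Q0 PQ.
have di := dist_gt0 i_le_n; have did := dist_gt0 idn.
have dm := dist_gt0 m_le_n; have dm1 := dist_gt0 m_lt_n.
have dmh := @dist_left_ub m (leqnn m); rewrite subSnn mul1r in dmh.
have dm1h := dist_right_ub m1_range; rewrite subSnn mul1r in dm1h.
have PQ0 : 0 <= P i / Q by rewrite divr_ge0 ?inv_dist_prod_ge0 ?ltW.
(* [Q] dominates the nearest central product, so only the quotient of end distances remains. *)
have to_ends k : P i * (dist i * dist (i + d)%N) <= dist m * dist m.+1 * P k ->
    (k <= m < k + d)%N -> (k + d <= n)%N ->
    P i / Q <= dist m * dist m.+1 / (dist i * dist (i + d)%N).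
  move=> hP hk kdn; rewrite ler_pdivrMr // mulrAC ler_pdivlMr ?mulr_gt0 //.
  by apply: le_trans hP _; apply: ler_wpM2l; rewrite ?PQ // mulr_ge0.
case: leqP => idm.
  have [midk kdn im far] := left_idx idm.
  have hPQ := to_ends _ (inv_dist_prod_left_le idm) midk kdn.
  (* Left of [y] the nearer stencil end is [x (i + d)]; in the right case the two sides exchange
     roles. *)
  have [|||le1 le2] := @end_ratio_le _ h hs (dist m) (dist m.+1) (dist (i + d)%N)
    (dist i) (m - (i + d)) hs_gt0 hs_le_h dm dm1 dmh dm1h.
  - by apply: dist_left_le; rewrite idm /=.
  - exact: dist_left_lb.
  - apply: le_trans (dist_left_lb im).
    by rewrite ler_pM2r // ler_nat.
  rewrite [dist (i + d)%N * _]mulrC in le1 le2.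
  by apply: power_bound => //; exact: le_trans hPQ _.
case: leqP => im.
  by rewrite exprn_ile1 // ler_pdivrMr // mul1r PQ // mid_idx.
have [midk kdn idr ir far] := right_idx im.
have hPQ := to_ends _ (inv_dist_prod_right_le im idn) midk kdn.
have [|||le1 le2] := @end_ratio_le _ h hs (dist m.+1) (dist m) (dist i)
  (dist (i + d)%N) (i - m.+1) hs_gt0 hs_le_h dm1 dm dm1h dmh.
- exact: dist_right_le.
- exact: dist_right_lb.
- apply: le_trans (dist_right_lb idr).
  by rewrite ler_pM2r // ler_nat.
rewrite [dist m.+1 * _]mulrC in le1 le2.
by apply: power_bound => //; exact: le_trans hPQ _.
Qed.

Lemma sum_inv_dist_prod_ratio_le gamma Q :
  (1 < gamma)%N -> 0 < Q ->
  (forall k, (k <= m < k + d)%N -> (k + d <= n)%N -> P k <= Q) ->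
  \sum_(i < (n - d).+1) (P i / Q) ^+ gamma.-1
    <= 7 * d%:R * (h / hs) ^+ gamma.
Proof.
move=> g1.
have mid_idx i : (m.+1 - d <= i < minn m.+1 (n - d).+1)%N ->
    [/\ (i + d <= m)%N = false, (i <= m)%N & (i + d <= n)%N].
  by move=> hi; split; lia.
have mid_card : (minn m.+1 (n - d).+1 - (m.+1 - d) <= d)%N by lia.
move=> Q0 PQ.
have r1 : 1 <= (h / hs) ^+ gamma by rewrite exprn_ege1.
rewrite (@sum_ord_split _ (fun i => (P i / Q) ^+ gamma.-1)
  _ (m.+1 - d) m.+1); last by lia.
have left_le : \sum_(j < m.+1 - d) (P (m.+1 - d - j.+1)%N / Q) ^+ gamma.-1
    <= 3 * (h / hs) ^+ gamma.
  rewrite -[X in _ <= X]mulr1.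
  apply: le_trans (ler_wpM2l _ (sum_inv_consecutive_le1 R (m.+1 - d))); last first.
    by lra.
  rewrite mulr_sumr; apply: ler_sum => j _; have := ltn_ord j => hj.
  have := @inv_dist_prod_ratio gamma Q (m.+1 - d - j.+1) g1 ltac:(lia) Q0 PQ.
  have -> : (m.+1 - d - j.+1 + d <= m)%N by lia.
  by have -> : (m - (m.+1 - d - j.+1 + d) = j)%N by lia.
have right_le : \sum_(j < (n - d).+1 - m.+1) (P (m.+1 + j)%N / Q) ^+ gamma.-1
    <= 3 * (h / hs) ^+ gamma.
  rewrite -[X in _ <= X]mulr1.
  apply: le_trans (ler_wpM2l _ (sum_inv_consecutive_le1 R ((n - d).+1 - m.+1))).
    rewrite mulr_sumr; apply: ler_sum => j _; have := ltn_ord j => hj.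
    have := @inv_dist_prod_ratio gamma Q (m.+1 + j) g1 ltac:(lia) Q0 PQ.
    have -> : (m.+1 + j + d <= m)%N = false by lia.
    have -> : (m.+1 + j <= m)%N = false by lia.
    by have -> : (m.+1 + j - m.+1 = j)%N by lia.
  by lra.
have mid_le : \sum_(m.+1 - d <= i < minn m.+1 (n - d).+1) (P i / Q) ^+ gamma.-1
    <= d%:R.
  apply: (@le_trans _ _ (\sum_(m.+1 - d <= i < minn m.+1 (n - d).+1) 1)).
    rewrite !big_nat; apply: ler_sum => i hi.
    have [mid i_le_m idn] := mid_idx i hi.
    have := inv_dist_prod_ratio g1 idn Q0 PQ.
    by rewrite mid i_le_m.
  by rewrite sumr_const_nat ler_nat.
have d1 : 1 <= d%:R :> R by rewrite ler1n.
set r := (h / hs) ^+ gamma in r1 left_le right_le *.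
(* As [d] and [r] are at least 1, both are at most [d * r]; the three blocks give 3 + 1 + 3 = 7. *)
have : d%:R <= d%:R * r by rewrite ler_peMr.
have : r <= d%:R * r by rewrite ler_peMl //; lra.
by lra.
Qed.

(** * Basis functions and Lebesgue function off the nodes *)

(** With [V] the product [P i] without its factor at [k], the quotient of [V ^+ gamma.-1] by
    [(dist k * Q) ^+ gamma] regroups into [(P i / Q) ^+ gamma.-1] times [1 / (Q * dist k)]. *)
Lemma fh_basis_le gamma k Q :
  (0 < gamma)%N -> (k <= n)%N -> ~~ [exists j : 'I_n.+1, y == x j] ->
  0 < Q -> Q ^+ gamma <= `|fh_denom n d gamma x y| ->
  `|fh_basis n d gamma x k y| <=
    \sum_(i < (n - d).+1 | (k <= i + d)%N && (i <= k)%N) (P i / Q) ^+ gamma.-1 *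
      (Q^-1 * ((dist k)^-1 *
         (\prod_(i <= s < (i + d).+1 | s != k) `|x k - x s|)^-1)).
Proof.
case: gamma => // g _ kn not_node Q0 QD.
have dk := dist_gt0 kn.
rewrite /fh_basis (negbTE not_node) ifN; last first.
  apply: contra not_node => yk; apply/existsP.
  by exists (Ordinal (kn : (k < n.+1)%N)).
rewrite normrM normfV normrM normrX.
set D := `|fh_denom _ _ _ _ _| in QD *.
apply: (@le_trans _ _ (`|fh_weight n d g.+1 x k y| / (dist k ^+ g.+1 * Q ^+ g.+1))).
  apply: ler_wpM2l => //.
  by rewrite lef_pV2 ?posrE ?mulr_gt0 ?exprn_gt0 ?(lt_le_trans _ QD) ?exprn_gt0 //
     ler_pM2l ?exprn_gt0.
rewrite ler_pdivrMr ?mulr_gt0 ?exprn_gt0 // mulr_suml.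
apply: le_trans (ler_norm_sum _ _ _) _; apply: ler_sum => i /andP[kid ik].
rewrite normrM !normrX normrN1 !expr1n mul1r.
rewrite normr_prod.
rewrite (eq_bigr (fun s => `|x k - x s|^-1 * ((dist s)^-1) ^+ g)); last first.
  by move=> s _; rewrite normfV normrM normrX invfM exprVn.
rewrite big_split /= prodrXl prodfV /=.
set W := \prod_(_ <= _ < _ | _) `|_|; set V := \prod_(_ <= _ < _ | _) _.
have -> : P i = (dist k)^-1 * V.
  by rewrite /inv_dist_prod (bigD1_seq k) ?iota_uniq // mem_index_iota; lia.
rewrite !exprMn !exprVn !exprS le_eqVlt; apply/orP; left; apply/eqP.
set w := W^-1; set vg := V ^+ g.
have a0 : dist k ^+ g != 0 by rewrite expf_neq0 // gt_eqF.
have b0 : Q ^+ g != 0 by rewrite expf_neq0 // gt_eqF.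
set a := dist k ^+ g in a0 *; set b := Q ^+ g in b0 *.
by field; rewrite a0 b0 !gt_eqF.
Qed.

(** One power of [h] comes from [dist_mul_div_le], the other [d - 1] from the hypothesis on [Q];
    dividing [d!] by the factorials of [node_dist_prod_lb] gives the binomial. *)
Lemma weight_term_le Q i k :
  Q^-1 <= dist m * dist m.+1 * (d`!%:R * h ^+ d.-1) -> 0 < Q ->
  (i <= k <= i + d)%N -> (i + d <= n)%N ->
  Q^-1 * ((dist k)^-1 *
     (\prod_(i <= s < (i + d).+1 | s != k) `|x k - x s|)^-1)
  <= 'C(d, k - i)%:R * (h / hs) ^+ d.
Proof.
move=> hQ Q0 ik idn.
have kn : (k <= n)%N by lia.
have kd : (k - i <= d)%N by lia.
have fact_eq := bin_fact kd.
rewrite (_ : (d - (k - i) = i + d - k)%N) in fact_eq; last by lia.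
have dk := dist_gt0 kn.
have h0 : 0 < h := lt_le_trans hs_gt0 hs_le_h.
have hW := node_dist_prod_lb ik idn.
set W := \prod_(_ <= _ < _ | _) _ in hW *.
set f : R := ((k - i)`! * (i + d - k)`!)%:R in hW *.
have f0 : 0 < f by rewrite ltr0n muln_gt0 !fact_gt0.
have fhs0 : 0 < f * hs ^+ d by rewrite mulr_gt0 ?exprn_gt0.
have W0 : 0 < W := lt_le_trans fhs0 hW.
have hd : Q^-1 / dist k <= d`!%:R * h ^+ d.
  apply: (@le_trans _ _ (dist m * dist m.+1 / dist k * (d`!%:R * h ^+ d.-1))).
    by rewrite mulrAC ler_pM2r ?invr_gt0.
  apply: (@le_trans _ _ (h * (d`!%:R * h ^+ d.-1))).
    apply: ler_wpM2r; last exact: dist_mul_div_le.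
    by rewrite mulr_ge0 // exprn_ge0 // ltW.
  by rewrite mulrCA -exprS prednK.
rewrite mulrA ler_pdivrMr //.
apply: le_trans hd _.
apply: le_trans (ler_wpM2l _ hW); last first.
  by rewrite mulr_ge0 // exprn_ge0 // ltW // divr_gt0.
rewrite -fact_eq natrM -/f expr_div_n -mulrA [leRHS]mulrA.
rewrite le_eqVlt; apply/orP; left; apply/eqP.
have e0 : hs ^+ d != 0 by rewrite expf_neq0 // gt_eqF.
by set e := hs ^+ d in e0 *; field.
Qed.

Lemma fh_lebesgue_off_nodes gamma :
  (1 < gamma)%N -> ~~ [exists j : 'I_n.+1, y == x j] ->
  fh_lebesgue n d gamma x y <= 7 * d%:R * 2 ^+ d * (h / hs) ^+ (gamma + d).
Proof.
move=> g1 not_node.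
have stencil_le_n (i : 'I_(n - d).+1) : (i + d <= n)%N.
  by have := ltn_ord i; lia.
(* This index is a central stencil, so the maximum defining [Q] is over a nonempty set. *)
have mid0 : (minn m (n - d) < (n - d).+1)%N by lia.
pose mid (i : 'I_(n - d).+1) := (i <= m < i + d)%N.
have mid_ex : mid (Ordinal mid0) by rewrite /mid /=; lia.
case: (arg_maxP (fun i : 'I_(n - d).+1 => P i) mid_ex) => k midk kmax.
have kdn := stencil_le_n k.
have PQ i : (i <= m < i + d)%N -> (i + d <= n)%N -> P i <= P k.
  move=> hi idn; have lti : (i < (n - d).+1)%N by lia.
  exact: (kmax (Ordinal lti)).
have Q0 : 0 < P k by exact: inv_dist_prod_gt0.
have QD := fh_denom_lb gamma midk kdn.
have hQ := inv_dist_prod_lb midk kdn.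
have rd0 : 0 <= (h / hs) ^+ d by rewrite exprn_ge0 // (le_trans ler01).
rewrite /fh_lebesgue.
apply: (@le_trans _ _ (\sum_(j < n.+1) \sum_(i < (n - d).+1 |
    (j <= i + d)%N && (i <= j)%N)
    (P i / P k) ^+ gamma.-1 * ('C(d, j - i)%:R * (h / hs) ^+ d))).
  apply: ler_sum => j _; have := ltn_ord j => hj.
  apply: le_trans (fh_basis_le (ltnW g1) hj not_node Q0 QD) _.
  apply: ler_sum => i /andP[jid ij].
  apply: ler_wpM2l; first by rewrite exprn_ge0 // divr_ge0 ?inv_dist_prod_ge0.
  by apply: weight_term_le; rewrite ?ij.
(* For a fixed stencil the ratio is constant in [j], and the binomials over its nodes sum to
   [2 ^+ d]. *)
rewrite (exchange_big_dep xpredT) //=.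
apply: (@le_trans _ _ (\sum_(i < (n - d).+1)
    (P i / P k) ^+ gamma.-1 * (2 ^+ d * (h / hs) ^+ d))).
  apply: ler_sum => i _.
  by rewrite -mulr_sumr -mulr_suml -natr_sum sum_bin_window ?natrX.
rewrite -mulr_suml.
apply: le_trans (ler_wpM2r _ (sum_inv_dist_prod_ratio_le g1 Q0 PQ)) _.
  by rewrite mulr_ge0 // exprn_ge0.
by rewrite exprD le_eqVlt; apply/orP; left; apply/eqP; ring.
Qed.

End LocatedPoint.

(** * Values at the nodes and conclusion *)

(** Basis values at a node are 0 or 1 by definition; monotonicity makes the nodes distinct, so
    exactly one of them is 1. *)
Lemma fh_lebesgue_node (R : realType) (n d gamma : nat) (x : nat -> R) (j : nat) :
  (j <= n)%N -> (forall k, (k < n)%N -> x k < x k.+1) ->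
  fh_lebesgue n d gamma x (x j) = 1.
Proof.
move=> jn x_incr.
have jlt : (j < n.+1)%N by [].
rewrite /fh_lebesgue (bigD1 (Ordinal jlt)) //= /fh_basis eqxx normr1.
rewrite big1 ?addr0 // => k kj.
have -> : (x j == x k) = false.
  apply/negbTE; have : (j != k)%N by apply: contra kj => /eqP e; apply/eqP/val_inj.
  have := ltn_ord k => kn; rewrite neq_ltn => /orP[jk|kj'].
    by rewrite lt_eqF // (@node_lt _ n) //; lia.
  by rewrite gt_eqF // (@node_lt _ n) //; lia.
have -> : [exists j0 : 'I_n.+1, x j == x j0].
  by apply/existsP; exists (Ordinal jlt).
by rewrite normr0.
Qed.

Theorem theorem4p1 (R : realType) :
  exists C : R, 0 < C /\
    forall (n d gamma : nat) (a b : R) (x : nat -> R),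
      (1 <= d <= n)%N -> (1 < gamma)%N ->
      x 0%N = a -> x n = b ->
      (forall k : nat, (k < n)%N -> x k < x k.+1) ->
      forall y : R, a <= y <= b ->
        fh_lebesgue n d gamma x y <=
          C * d%:R * 2 ^+ d * (max_gap n x / min_gap n x) ^+ (gamma + d).
Proof.
(* The constant of [sum_inv_dist_prod_ratio_le]. *)
exists 7; split => // n d gamma a b x /andP[d0 dn] g1 <- <- x_incr y hy.
have n0 : (0 < n)%N by exact: leq_trans dn.
case: (boolP [exists j : 'I_n.+1, y == x j]) => [/existsP[j /eqP ->]|not_node].
  have jn : (j <= n)%N := ltn_ord j.
  rewrite fh_lebesgue_node //.
  (* At a node the value is 1 and every factor of the bound is at least 1. *)
  have r1 : 1 <= (max_gap n x / min_gap n x) ^+ (gamma + d).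
    by rewrite exprn_ege1 // ler_pdivlMr ?min_gap_gt0 // mul1r min_gap_le_max_gap.
  rewrite -[leLHS]mulr1; apply: ler_pM => //.
  by rewrite -natrM -natrX -natrM ler1n !muln_gt0 d0 expn_gt0 //.
have [|m mn ym] := between_consecutive hy.
  move=> k kn; apply: contra not_node => yk; apply/existsP.
  by exists (Ordinal (kn : (k < n.+1)%N)).
exact: fh_lebesgue_off_nodes ym _ _ _.
Qed.
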